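(* Let $N\ge 3$. The Laplacian of the barren graph $\mathrm{Barr}(N)$, which has $N+7$ vertices, has the following eigenvalues (listed with multiplicity), with linearly independent eigenvectors of the indicated form: (1) $\lambda_0=0$ (once), with constant eigenvector; (2) $\lambda_1=\frac12\left(N+3-\sqrt{N^2-2N+9}\right)$ (once) and $\frac12\left(N+3+\sqrt{N^2-2N+9}\right)$ (once), each with an eigenvector equal to $a$ on $V_3$, $-a$ on $V_4$, $b$ on $V_5$, $-b$ on $V_6$ and $0$ on $V_1\cup V_2$, for some real numbers $a,b$ (depending on the eigenvalue); (3) the three roots $y_1,y_2,y_3$ of the cubic polynomial $\lambda^3+(-2N-8)\lambda^2+(N^2+10N+15)\lambda+(-2N^2-14N)$ (once each), each with an eigenvector that is constant on each of $V_1$, $V_2$, $V_3\cup V_4$, $V_5\cup V_6$; (4) $5$, with multiplicity $N-1$ in this list, with eigenvectors any orthonormal basis of the space of functions supported on $V_1$ and orthogonal to the constants; (5) $N+1$, with multiplicity $2$ in this list, with eigenvectors supported on $V_3\cup V_4$ taking the values $a,-a$ on the two vertices of $V_3$ and $b,-b$ (resp. $-b,b$) on the two vertices of $V_4$, with $a,b$ real. Here $\lambda_1$ is the smallest positive eigenvalue. In particular, the Fiedler vector $\varphi_1$ of $\mathrm{Barr}(N)$ vanishes on $V_1\cup V_2$, and hence $|\operatorname{supp}(\varphi_1)|=6$ for every $N\ge 3$.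
   Context: The Laplacian of a finite simple undirected graph is $Lf(x)=\sum_{y\sim x}(f(x)-f(y))$. A Fiedler vector $\varphi_1$ of a connected graph is an eigenvector of $L$ for its smallest positive eigenvalue $\lambda_1$. For disjoint vertex sets $V_i,V_j$, $K(V_i,V_j)$ denotes the complete bipartite graph with vertex set $V_i\cup V_j$ and edges between every $x\in V_i$ and every $y\in V_j$. The sum of graphs is the graph obtained by taking the union of their edge sets (on the union of the vertex sets). For $N\ge3$, let $V_1,\dots,V_6$ be pairwise disjoint sets with $|V_1|=N$, $|V_2|=1$, $|V_3|=2$, $|V_4|=2$, $|V_5|=1$, $|V_6|=1$. The barren graph is $\mathrm{Barr}(N)=K(V_1,V_2)+K(V_1,V_3)+K(V_1,V_4)+K(V_3,V_5)+K(V_4,V_6)$, on $N+7$ vertices. $\operatorname{supp}(f)$ is the set of vertices where $f\ne0$. *)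

(* Defs.v *)
From HB Require Import structures.
From mathcomp Require Import all_boot all_order all_algebra.

Set Implicit Arguments.
Unset Strict Implicit.
Unset Printing Implicit Defensive.

Import Order.TTheory GRing.Theory Num.Theory.
Local Open Scope ring_scope.

Record sgraph (T : finType) := SGraph {
  vset : {set T};
  eset : {set {set T}};
  eset_simple : {in eset, forall e : {set T}, #|e| = 2%N /\ e \subset vset}
}.

Definition adj (T : finType) (G : sgraph T) : rel T :=
  fun x y => [set x; y] \in eset G.

Definition connected (T : finType) (G : sgraph T) : Prop :=
  {in vset G &, forall x y, connect (adj G) x y}.

Section GraphOperations.
Variable T : finType.
Implicit Types (A B : {set T}) (G H : sgraph T).

(* The side condition x != y is vacuous when A and B are disjoint; it makes
   the construction total. *)
Definition Kedges A B : {set {set T}} :=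
  [set [set x; y] | x in A, y in B & x != y].

Fact Kedges_simple A B :
  {in Kedges A B, forall e : {set T}, #|e| = 2%N /\ e \subset A :|: B}.
Proof.
move=> e /imset2P[x y xA]; rewrite !inE => /andP[yB xy] ->.
rewrite cards2 xy; split=> //; apply/subsetP=> z.
by rewrite !inE => /orP[] /eqP->; rewrite ?xA ?yB ?orbT.
Qed.

Definition K A B : sgraph T := SGraph (@Kedges_simple A B).

Fact gsum_simple G H :
  {in eset G :|: eset H,
     forall e : {set T}, #|e| = 2%N /\ e \subset vset G :|: vset H}.
Proof.
by move=> e; rewrite inE => /orP[] /eset_simple[-> sub]; split=> //;
  apply: subset_trans sub _; rewrite ?subsetUl ?subsetUr.
Qed.

Definition gsum G H : sgraph T := SGraph (@gsum_simple G H).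

Local Notation "G +g H" := (gsum G H) (at level 50, left associativity).

Definition barren (V1 V2 V3 V4 V5 V6 : {set T}) : sgraph T :=
  K V1 V2 +g K V1 V3 +g K V1 V4 +g K V3 V5 +g K V4 V6.

End GraphOperations.

Section Functions.
Variables (R : rcfType) (T : finType).
Local Notation W := {ffun T -> R^o}.
Implicit Types (f g : W) (A : {set T}) (G : sgraph T).

(* Functions live on the whole of T, so this is the Laplacian of G on its own
   vertex set exactly when vset G = [set: T]. *)
Definition laplacian_fun G f : W :=
  [ffun x => \sum_(y | adj G x y) (f x - f y)].

Fact laplacian_fun_linear G : linear (laplacian_fun G).
Proof.
move=> a f g; apply/ffunP=> x; rewrite !ffunE scaler_sumr -big_split /=.
by apply: eq_bigr => y _; rewrite !ffunE scalerBr opprD addrACA.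
Qed.

HB.instance Definition _ G :=
  GRing.isLinear.Build R W W *:%R (laplacian_fun G) (@laplacian_fun_linear G).

Definition laplacian G : 'End(W) := linfun (laplacian_fun G).

Fact laplacianE G f x :
  laplacian G f x = \sum_(y | adj G x y) (f x - f y).
Proof. by rewrite lfunE ffunE. Qed.

Definition eigenvector (L : 'End(W)) (mu : R) f : Prop :=
  f != 0 /\ L f = mu *: f.

Definition smallest_pos_eigenvalue (L : 'End(W)) (mu : R) : Prop :=
  [/\ passmx.leigenvalue L mu, 0 < mu &
      forall nu : R, passmx.leigenvalue L nu -> 0 < nu -> mu <= nu].

Definition fiedler_vector G f : Prop :=
  exists2 mu : R, smallest_pos_eigenvalue (laplacian G) mu &
                  eigenvector (laplacian G) mu f.

Definition supp f : {set T} := [set x | f x != 0].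

Definition constant_on A f : Prop := {in A &, forall x y, f x = f y}.

Definition equals_on A f (c : R) : Prop := {in A, forall x, f x = c}.

Definition dotf f g : R := \sum_x f x * g x.

Definition orthonormal (s : seq W) : Prop :=
  forall i j, (i < size s)%N -> (j < size s)%N -> dotf s`_i s`_j = (i == j)%:R.

Definition orthonormal_basis_of (P : W -> Prop) (s : seq W) : Prop :=
  orthonormal s /\ (forall f, f \in <<s>>%VS <-> P f).

Definition supported_orth_const A f : Prop :=
  supp f \subset A /\ (forall g, constant_on [set: T] g -> dotf f g = 0).

Definition two_pairs (u u' v v' : T) (a b : R) : W :=
  [ffun x => if x == u then a else if x == u' then - a
             else if x == v then b else if x == v' then - b else 0].

End Functions.

Definition barren_cubic (R : rcfType) (N : nat) : {poly R} :=
  'X^3 + (- 2 * N%:R - 8) *: 'X^2 + (N%:R ^+ 2 + 10 * N%:R + 15) *: 'X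
    + (- 2 * N%:R ^+ 2 - 14 * N%:R)%:P.

(* Main.v *)
Require Import Defs.
From HB Require Import structures.
From mathcomp Require Import all_boot all_order all_algebra.
From mathcomp Require Import ring lra.

Set Implicit Arguments.
Unset Strict Implicit.
Unset Printing Implicit Defensive.

Import Order.TTheory GRing.Theory Num.Theory.
Local Open Scope ring_scope.

(** The barren graph is invariant under permuting V1, under swapping the two
    vertices of V3 or of V4, and under exchanging the arms V3, V5 and V4, V6.
    Its Laplacian therefore preserves the following mutually orthogonal spaces,
    which together span all functions.

    - Functions on V1 with sum zero (dimension N - 1): every vertex of V1 has
      degree 5 and all the neighbour sums vanish, so L acts as 5.
    - Functions on V3 and V4 with sum zero on each (dimension 2): for the same
      reason L acts as the degree N + 1.
    - Functions constant on blocks and odd under the exchange of arms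
      (dimension 2): L has the characteristic polynomial
      q = x^2 - (N+3) x + 2 N, whose roots are lam1 and lam2.
    - Functions constant on blocks and even under the exchange of arms
      (dimension 4): L has the characteristic polynomial x p, where p is the
      cubic of the statement; the factor x comes from the constants.

    The crucial identity is p = (x - (N+5)) q - 4 N ([cubicE]): p and q have no
    common root.  A sign analysis of p at 2, N, N + 1 and at a large point
    ([cubic_roots]) puts its roots in [2, N), (N, N+1) and (N+1, +oo), so that
    0, lam1, lam2 and the roots of p are six distinct numbers, all different
    from 5 and N + 1.  As L is self-adjoint, eigenvectors for distinct
    eigenvalues are orthogonal, which makes the proposed family of N + 7
    eigenvectors free, hence a basis ([free_eigenbasis]).  The dimension of an
    eigenspace is then the number of basis vectors with that eigenvalue
    ([dim_leigenspace_count]).  Finally 0 < lam1 < 2 while every other nonzero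
    eigenvalue is at least 2, so the Fiedler vector is, up to a scalar, the odd
    vector for lam1, which is nonzero exactly on the six vertices outside V1
    and V2. *)

(** * Eigenspaces of a diagonalised endomorphism *)

Section Diagonalised.
Variables (F : fieldType) (V : vectType F) (L : 'End(V)).

Lemma mem_leigenspace mu (v : V) :
  (v \in passmx.leigenspace L mu) = (L v == mu *: v).
Proof.
by rewrite memv_ker add_lfunE opp_lfunE scale_lfunE id_lfunE subr_eq0.
Qed.

(** Expanding [L v - mu *: v = 0] in the basis gives a coefficient
    [k x * (e x - mu)] on each [x], so only the [x] with [e x = mu] survive. *)
Lemma leigenspace_filter (e : V -> F) (X : seq V) mu :
    basis_of fullv X -> {in X, forall x, L x = e x *: x} ->
  passmx.leigenspace L mu = <<[seq x <- X | e x == mu]>>%VS.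
Proof.
move=> basX LX; have freeX := basis_free basX; apply/eqP.
rewrite eqEsubv; apply/andP; split; last first.
  apply/span_subvP=> x; rewrite mem_filter mem_leigenspace.
  by case/andP=> /eqP <- /LX ->.
apply/subvP=> v; rewrite mem_leigenspace => /eqP Lv.
have [k def_v _] : {k : V -> F | v = \sum_(x <- X) k x *: x &
                    forall k1, v = \sum_(x <- X) k1 x *: x -> {in X, k1 =1 k}}.
  by apply: free_span => //; rewrite (span_basis basX) memvf.
(* k0 is only a reference point: two expansions of 0 both agree with it. *)
have [k0 _ k0_uniq] := free_span freeX (mem0v _).
have coef0 : {in X, forall x, k x * (e x - mu) = 0}.
  move=> x Xx; rewrite (k0_uniq (fun x => k x * (e x - mu)) _ x Xx).
    rewrite -(k0_uniq (fun=> 0)) //.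
    by rewrite big1 // => y _; rewrite scale0r.
  apply: etrans (_ : L v - mu *: v = _); first by rewrite Lv subrr.
  rewrite def_v linear_sum scaler_sumr -sumrB; apply: eq_big_seq => y Xy.
  by rewrite linearZ /= LX // !scalerA -scalerBl mulrBr [mu * _]mulrC.
rewrite def_v big_seq; apply: rpred_sum => x Xx.
have [exmu|exmu] := eqVneq (e x) mu.
  by apply: rpredZ; apply: memv_span; rewrite mem_filter exmu eqxx.
have /eqP := coef0 x Xx; rewrite mulf_eq0 subr_eq0 (negPf exmu) orbF.
by move=> /eqP->; rewrite scale0r mem0v.
Qed.

(** The eigenvalues are given as a list parallel to the basis, so that a
    spectrum listed with multiplicity reads off the dimensions. *)
Lemma dim_leigenspace_count (s : seq F) (X : seq V) mu :
    basis_of fullv X -> size s = size X ->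
    {in zip s X, forall p, L p.2 = p.1 *: p.2} ->
  \dim (passmx.leigenspace L mu) = count_mem mu s.
Proof.
move=> basX sX LsX; have freeX := basis_free basX.
pose e x := s`_(index x X).
have LX : {in X, forall x, L x = e x *: x}.
  move=> x Xx; apply: (LsX (e x, x)).
  rewrite -[x in (_, x)](nth_index 0 Xx) -nth_zip //.
  by rewrite mem_nth // size_zip sX minnn index_mem.
have -> : s = map e X.
  apply: (@eq_from_nth _ 0); rewrite ?size_map // => i.
  rewrite sX => ltiX; rewrite (nth_map 0) // /e index_uniq //.
  exact: free_uniq.
rewrite (leigenspace_filter mu basX LX).
have /eqP -> : free [seq x <- X | e x == mu] by apply: filter_free.
by rewrite size_filter count_map.
Qed.

End Diagonalised.

(** * The inner product on real functions *)

Section InnerProduct.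
Variables (R : rcfType) (T : finType).
Local Notation W := {ffun T -> R^o}.
Implicit Types (f g : W) (X Y : seq W).

Lemma scale_ffunE (a : R) f x : (a *: f) x = a * f x.
Proof. by rewrite ffunE. Qed.

Lemma dotfC f g : dotf f g = dotf g f.
Proof. by apply: eq_bigr => x _; rewrite mulrC. Qed.

(** The codomain is [R^o], the one-dimensional vector space, so that
    orthogonal complements become kernels in the sense of [lker]. *)
Definition dotr g f : R^o := dotf f g.

Fact dotr_linear g : linear (dotr g).
Proof.
move=> a f h; rewrite /dotr /dotf scaler_sumr -big_split.
by apply: eq_bigr => x _ /=; rewrite ffunE scale_ffunE mulrDl -mulrA.
Qed.

HB.instance Definition _ g :=
  GRing.isLinear.Build R W R^o *:%R (dotr g) (dotr_linear g).

Definition dotl g : 'Hom(W, R^o) := linfun (dotr g).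

Lemma dotlE g f : dotl g f = dotf f g.
Proof. by rewrite lfunE. Qed.

Lemma mem_lker_dotl g f : (f \in lker (dotl g)) = (dotf f g == 0).
Proof. by rewrite memv_ker dotlE. Qed.

Lemma dotfDl f h g : dotf (f + h) g = dotf f g + dotf h g.
Proof. by rewrite -!dotlE linearD. Qed.

Lemma dotfZl a f g : dotf (a *: f) g = a * dotf f g.
Proof. by rewrite -!dotlE linearZ. Qed.

Lemma dotfZr a f g : dotf f (a *: g) = a * dotf f g.
Proof. by rewrite dotfC dotfZl dotfC. Qed.

Lemma dotf_ge0 f : 0 <= dotf f f.
Proof. by apply: sumr_ge0 => x _; rewrite -expr2 sqr_ge0. Qed.

Lemma dotf_eq0 f : (dotf f f == 0) = (f == 0).
Proof.
apply/eqP/eqP=> [f0|->]; last first.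
  by rewrite /dotf big1 // => x _; rewrite ffunE mul0r.
apply/ffunP=> x; rewrite ffunE; apply/eqP; rewrite -sqrf_eq0 expr2.
by apply/eqP; apply: psumr_eq0P f0 x isT => y _; rewrite -expr2 sqr_ge0.
Qed.

Lemma orthogonal_span X g :
  {in X, forall f, dotf f g = 0} -> {in <<X>>%VS, forall f, dotf f g = 0}.
Proof.
move=> Xg f Xf; apply/eqP; rewrite -mem_lker_dotl.
apply: subvP f Xf; apply/span_subvP => h /Xg hg.
by rewrite mem_lker_dotl hg.
Qed.

Lemma free_orthogonal_cat X Y :
    free X -> free Y -> {in X & Y, forall f g, dotf f g = 0} ->
  free (X ++ Y).
Proof.
move=> freeX freeY XY; rewrite cat_free freeX freeY /=; apply/directv_addP.
apply/eqP; rewrite -subv0; apply/subvP=> f; rewrite memv_cap memv0.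
case/andP=> Xf Yf; rewrite -dotf_eq0; apply/eqP.
apply: orthogonal_span Xf => h Xh; rewrite dotfC.
by apply: orthogonal_span Yf => k Yk; rewrite dotfC XY.
Qed.

Lemma free_pairwise_orthogonal X :
  0 \notin X -> pairwise (fun f g => dotf f g == 0) X -> free X.
Proof.
elim: X => [|f X IHX]; first by rewrite nil_free.
rewrite inE negb_or /= => /andP[f0 X0] /andP[/allP fX orthX].
rewrite -cat1s free_orthogonal_cat ?IHX //; first by rewrite seq1_free eq_sym.
by move=> g h; rewrite inE => /eqP-> /fX/eqP.
Qed.

Lemma free_orthonormal X : Defs.orthonormal X -> free X.
Proof.
move=> orthX; apply: free_pairwise_orthogonal.
  apply/negP=> X0; have := orthX (index 0 X) (index 0 X).
  rewrite index_mem X0 nth_index // eqxx => /(_ isT isT) dot00.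
  by have := dotf_eq0 0; rewrite dot00 oner_eq0 eqxx.
apply/(pairwiseP 0)=> i j iX jX ltij.
by rewrite orthX // ltn_eqF.
Qed.

(** Gram-Schmidt, one vector at a time: normalise some vector of [U] and
    recurse in its orthogonal complement within [U]. *)
Lemma orthonormal_basis_exists (U : {vspace W}) :
  exists2 s : seq W, Defs.orthonormal s & <<s>>%VS = U.
Proof.
have [n] := ubnP (\dim U); elim: n U => // n IHn U; rewrite ltnS => leUn.
have [->|U0] := eqVneq U 0%VS; first by exists [::]; rewrite ?span_nil.
set v := vpick U; have v0 : dotf v v != 0 by rewrite dotf_eq0 vpick0.
have vv_gt0 : 0 < dotf v v by rewrite lt_def v0 dotf_ge0.
pose w := (Num.sqrt (dotf v v))^-1 *: v.
have ww : dotf w w = 1.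
  rewrite dotfZl dotfZr mulrA -invfM -expr2 sqr_sqrtr ?mulVf //.
  exact: dotf_ge0.
have Uw : w \in U by rewrite rpredZ ?memv_pick.
have [|s orths spans] := IHn (U :&: lker (dotl w))%VS.
  apply: leq_trans leUn; rewrite (ltn_leqif (dimv_leqif_sup (capvSl _ _))).
  apply/negP=> /subvP/(_ w Uw); rewrite memv_cap mem_lker_dotl ww oner_eq0.
  by rewrite andbF.
have ws : {in s, forall f, dotf f w = 0}.
  move=> f /memv_span; rewrite spans memv_cap mem_lker_dotl.
  by case/andP=> _ /eqP.
exists (w :: s).
  move=> [|i] [|j] //= ltis ltjs; first by rewrite dotfC ws // mem_nth.
    by rewrite ws // mem_nth.
  exact: orths.
rewrite span_cons spans; apply/eqP; rewrite eqEsubv subv_add capvSl andbT.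
rewrite -memvE Uw /=; apply/subvP=> f Uf.
rewrite -(subrK (dotf f w *: w) f) addrC memv_add //.
  by rewrite rpredZ // memv_line.
rewrite memv_cap; apply/andP; split.
  by apply: rpredB => //; apply: rpredZ.
by rewrite mem_lker_dotl -scaleNr dotfDl dotfZl ww mulr1 subrr.
Qed.

(** * Functions supported on a set *)

Definition delta x : W := [ffun y => (y == x)%:R].

Lemma eq0_off_supp (A : {set T}) f x :
  supp f \subset A -> x \notin A -> f x = 0.
Proof.
move=> /subsetP fA xA; apply/eqP; apply: contraR xA => fx.
by apply: fA; rewrite inE.
Qed.

Lemma dotf_delta f x : dotf f (delta x) = f x.
Proof.
rewrite /dotf (bigD1 x) //= ffunE eqxx mulr1 big1 ?addr0 // => y /negPf yx.
by rewrite ffunE yx mulr0.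
Qed.

Definition deltas (A : {set T}) : seq W := [seq delta x | x <- enum A].

Lemma free_deltas A : free (deltas A).
Proof.
apply: free_orthonormal => i j; rewrite size_map -cardE => iA jA.
have [x0 _] : exists x, x \in A by apply/card_gt0P; apply: leq_trans iA.
rewrite !(nth_map x0) -?cardE // dotf_delta ffunE.
by rewrite nth_uniq ?enum_uniq -?cardE // eq_sym.
Qed.

Lemma mem_span_deltas A f : (f \in <<deltas A>>%VS) = (supp f \subset A).
Proof.
apply/idP/idP=> [Af|fA].
  apply/subsetP=> x; rewrite inE; apply: contraR => xA.
  rewrite -dotf_delta; apply/eqP.
  apply: orthogonal_span Af => _ /mapP[y yA ->].
  rewrite dotf_delta ffunE; case: eqP xA => // ->.
  by rewrite -mem_enum yA.
have -> : f = \sum_(x in A) f x *: delta x.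
  apply/ffunP=> y; rewrite sum_ffunE.
  have [yA|yA] := boolP (y \in A).
    rewrite (bigD1 y) //= scale_ffunE ffunE eqxx mulr1 big1 ?addr0 //.
    by move=> x /andP[_ xy]; rewrite scale_ffunE ffunE eq_sym (negPf xy) mulr0.
  rewrite big1 => [|x xA]; last first.
    rewrite scale_ffunE ffunE; case: eqP xA yA => [->->|] //.
    by rewrite mulr0.
  exact: eq0_off_supp fA yA.
apply: rpred_sum => x xA; apply: rpredZ; apply: memv_span.
by apply: map_f; rewrite mem_enum.
Qed.

Lemma dim_span_deltas A : \dim <<deltas A>>%VS = #|A|.
Proof. by rewrite (eqP (free_deltas A)) size_map -cardE. Qed.

Lemma dim_functions : \dim {:W} = #|T|.
Proof.
rewrite -cardsT -dim_span_deltas; congr (\dim _); apply/vspaceP=> f.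
by rewrite memvf mem_span_deltas subsetT.
Qed.

Definition cst (c : R) : W := [ffun=> c].

Lemma dotf_cst f c : dotf f (cst c) = (\sum_x f x) * c.
Proof. by rewrite big_distrl; apply: eq_bigr => x _; rewrite ffunE. Qed.

(** Orthogonality to the constant 1 is what turns the condition on all
    constants into the kernel of one linear form. *)
Definition zero_sum_space A : {vspace W} :=
  (<<deltas A>> :&: lker (dotl (cst 1)))%VS.

Lemma mem_zero_sum_space A f :
  (f \in zero_sum_space A) = (supp f \subset A) && (\sum_x f x == 0).
Proof.
by rewrite memv_cap mem_span_deltas mem_lker_dotl dotf_cst mulr1.
Qed.

Lemma supported_orth_constP A f :
  reflect (supported_orth_const A f) (f \in zero_sum_space A).
Proof.
rewrite mem_zero_sum_space.
apply: (iffP andP) => [[fA /eqP f0]|[fA f0]]; split=> //.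
  move=> g g_const; case: (pickP T) => [x _|T0].
    have -> : g = cst (g x) by apply/ffunP=> y; rewrite ffunE; apply: g_const.
    by rewrite dotf_cst f0 mul0r.
  by rewrite /dotf big1 // => x; have := T0 x.
by rewrite -[X in X == _]mulr1 -dotf_cst f0 // => x y; rewrite !ffunE.
Qed.

(** Rank-nullity for the sum, which is onto the line as soon as [A] contains a
    point; for an empty [A] both sides are 0. *)
Lemma dim_zero_sum_space A : \dim (zero_sum_space A) = #|A|.-1.
Proof.
have := limg_ker_dim (dotl (cst 1)) <<deltas A>>.
rewrite -/(zero_sum_space A) dim_span_deltas.
have [A0|[x xA]] := set_0Vmem A.
  by rewrite A0 cards0 => /eqP; rewrite addn_eq0 => /andP[/eqP-> _].
suff -> : \dim (dotl (cst 1) @: <<deltas A>>) = 1%N by rewrite addn1 => <-.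
apply/eqP; rewrite eqn_leq; apply/andP; split.
  by apply: leq_trans (dimvS (subvf _)) _; rewrite dimvf.
rewrite lt0n dimv_eq0; apply/eqP=> img0.
have : dotl (cst 1) (delta x) \in (0 : {vspace R^o})%VS.
  by rewrite -img0 memv_img // memv_span // map_f ?mem_enum.
by rewrite memv0 dotlE dotfC dotf_delta ffunE oner_eq0.
Qed.

Lemma orthonormal_basis_span A (h : seq W) :
    orthonormal_basis_of (supported_orth_const A) h ->
  <<h>>%VS = zero_sum_space A.
Proof.
by case=> _ hP; apply/vspaceP=> f; apply/idP/supported_orth_constP=> /hP.
Qed.

Lemma size_orthonormal_basis A (h : seq W) :
    orthonormal_basis_of (supported_orth_const A) h -> size h = #|A|.-1.
Proof.
move=> hA; rewrite -dim_zero_sum_space -(orthonormal_basis_span hA).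
by have [/free_orthonormal/eqP->] := hA.
Qed.

Lemma supported_orth_const_basis A :
  exists h : seq W, orthonormal_basis_of (@supported_orth_const R T A) h.
Proof.
have [h orth_h span_h] := orthonormal_basis_exists (zero_sum_space A).
exists h; split=> // f; rewrite span_h.
by split=> /supported_orth_constP.
Qed.

End InnerProduct.

(** * The characteristic polynomials of the two quotients *)

Section Spectrum.
Variables (R : rcfType) (n : R).

(** Characteristic polynomial of the Laplacian on block functions that are odd
    under the exchange of the two arms. *)
Definition quadratic (x : R) : R := x ^+ 2 - (n + 3) * x + 2 * n.

(** Characteristic polynomial, without its root 0, of the Laplacian on block
    functions that are even under the exchange of the two arms. *)
Definition cubic (x : R) : R :=
  x ^+ 3 + (- 2 * n - 8) * x ^+ 2 + (n ^+ 2 + 10 * n + 15) * x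
    + (- 2 * n ^+ 2 - 14 * n).

Definition cubic_poly : {poly R} :=
  'X^3 + (- 2 * n - 8) *: 'X^2 + (n ^+ 2 + 10 * n + 15) *: 'X
    + (- 2 * n ^+ 2 - 14 * n)%:P.

Lemma horner_cubic_poly x : cubic_poly.[x] = cubic x.
Proof. by rewrite !(hornerD, hornerZ, hornerXn, hornerX, hornerC). Qed.

(** Euclidean division by the quadratic: the remainder is a nonzero constant, so
    the two polynomials share no root. *)
Lemma cubicE x : cubic x = (x - (n + 5)) * quadratic x - 4 * n.
Proof. by rewrite /cubic /quadratic; ring. Qed.

Let s : R := Num.sqrt (n ^+ 2 - 2 * n + 9).
Definition qroot1 : R := (n + 3 - s) / 2.
Definition qroot2 : R := (n + 3 + s) / 2.

Lemma sqrt_discr_bounds : 3 <= n ->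
  [/\ s ^+ 2 = n ^+ 2 - 2 * n + 9, n - 1 < s & s < n + 3].
Proof.
move=> n_ge3.
have D0 : 0 <= n ^+ 2 - 2 * n + 9 by nra.
have ss := sqr_sqrtr D0; rewrite -/s in ss.
have s0 : 0 <= s by apply: sqrtr_ge0.
have n1 : 0 <= n - 1 by lra.
have n3 : 0 <= n + 3 by lra.
by split=> //; rewrite -(@ltr_pXn2r _ 2) ?ss ?nnegrE //; lra.
Qed.

Lemma quadratic_roots : 3 <= n ->
  quadratic qroot1 = 0 /\ quadratic qroot2 = 0.
Proof.
move=> n_ge3.
have [ss _ _] := sqrt_discr_bounds n_ge3.
have E (t : R) : t ^+ 2 = s ^+ 2 -> quadratic ((n + 3 + t) / 2) = 0.
  move=> tt; transitivity ((t ^+ 2 - (n ^+ 2 - 2 * n + 9)) / 4).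
    by rewrite /quadratic; field.
  by rewrite tt ss subrr mul0r.
by split; apply: E; rewrite ?sqrrN.
Qed.

Lemma quadratic_roots_bounds : 3 <= n ->
  [/\ 0 < qroot1, qroot1 < 2 & n + 1 < qroot2].
Proof.
move=> n_ge3.
have [_ lts gts] := sqrt_discr_bounds n_ge3.
by split; rewrite /qroot1 /qroot2; lra.
Qed.

(** The cubic is nonpositive at 2 (it is [6 - 2 n] there), positive at [n],
    negative at [n + 1] and nonnegative far away; each change of sign gives one
    root. *)
Lemma cubic_roots : 3 <= n ->
  exists y1 y2 y3 : R,
  [/\ 2 <= y1 < n, n < y2 < n + 1, n + 1 < y3,
      cubic y1 = 0 & cubic y2 = 0 /\ cubic y3 = 0].
Proof.
move=> n_ge3.
pose p := cubic_poly; have pE : forall x, p.[x] = cubic x := horner_cubic_poly.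
have c2 : cubic 2 <= 0 by rewrite /cubic; lra.
have cn : 0 < cubic n.
  by rewrite (_ : cubic n = n); [lra | rewrite /cubic; ring].
have cn1 : cubic (n + 1) < 0.
  by rewrite (_ : cubic _ = 8 - 4 * n); [lra | rewrite /cubic; ring].
(* At 2 n + 8 the two terms of highest degree cancel. *)
have cbig : 0 <= cubic (2 * n + 8).
  rewrite (_ : cubic _ = (n ^+ 2 + 10 * n + 15) * (2 * n + 8)
                         + (- 2 * n ^+ 2 - 14 * n)).
    by nra.
  by rewrite /cubic; ring.
have neq x y : cubic x = 0 -> cubic y != 0 -> x != y.
  by move=> x0; apply: contraNneq => <-; rewrite x0.
have [||y1 y1_in] := @poly_ivt R p 2 n; rewrite ?pE; [lra|lra|].
rewrite rootE pE => /eqP y10.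
have [||y2 y2_in] := @poly_ivt R (- p) n (n + 1);
  rewrite ?hornerN ?pE; [lra|lra|].
rewrite rootN rootE pE => /eqP y20.
have [||y3 y3_in] := @poly_ivt R p (n + 1) (2 * n + 8); rewrite ?pE; [lra|lra|].
rewrite rootE pE => /eqP y30.
have cn0 := lt0r_neq0 cn; have cn10 : cubic (n + 1) != 0 by rewrite lt_eqF.
exists y1, y2, y3; move: y1_in y2_in y3_in.
move=> /andP[? y1n] /andP[ny2 y2n] /andP[ny3 _]; split=> //.
- by rewrite lt_def y1n eq_sym neq ?andbT //; apply/andP.
- by rewrite !lt_def y2n ny2 neq // eq_sym neq.
- by rewrite lt_def ny3 neq.
Qed.

Lemma uniq_spectrum y1 y2 y3 : 3 <= n ->
    2 <= y1 < n -> n < y2 < n + 1 -> n + 1 < y3 ->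
    cubic y1 = 0 -> cubic y2 = 0 -> cubic y3 = 0 ->
  uniq [:: 0; qroot1; qroot2; y1; y2; y3].
Proof.
move=> n_ge3 /andP[le2y1 y1n] /andP[ny2 y2n] ny3 c1 c2 c3.
have [l1_gt0 l1_lt2 l2_gt] := quadratic_roots_bounds n_ge3.
have [_ q2] := quadratic_roots n_ge3.
have l2y y : cubic y = 0 -> qroot2 != y.
  move=> cy; apply/eqP=> l2y; move: cy; rewrite cubicE -l2y q2 mulr0; lra.
rewrite /= !inE !negb_or !l2y //= !lt_eqF //; lra.
Qed.

Lemma cubic_poly_factor y1 y2 y3 :
    uniq [:: y1; y2; y3] -> cubic y1 = 0 -> cubic y2 = 0 -> cubic y3 = 0 ->
  cubic_poly = ('X - y1%:P) * ('X - y2%:P) * ('X - y3%:P).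
Proof.
move=> y_uniq c1 c2 c3.
pose low : {poly R} := (- 2 * n - 8) *: 'X^2 + (n ^+ 2 + 10 * n + 15) *: 'X
    + (- 2 * n ^+ 2 - 14 * n)%:P.
have size_low : (size low < size ('X^3 : {poly R}))%N.
  rewrite size_polyXn ltnS; apply/leq_sizeP => -[|[|[|j]]] // _.
  by rewrite !(coefD, coefZ, coefXn, coefX, coefC) /= !mulr0 !addr0.
have cubic_sum : cubic_poly = 'X^3 + low by rewrite /cubic_poly !addrA.
rewrite (@all_roots_prod_XsubC R cubic_poly [:: y1; y2; y3]).
- rewrite cubic_sum lead_coefDl // lead_coefXn scale1r.
  by rewrite !big_cons big_nil mulr1 mulrA.
- by rewrite cubic_sum size_polyDl // size_polyXn.
- by rewrite /= !rootE !horner_cubic_poly c1 c2 c3 eqxx.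
- by rewrite uniq_rootsE.
Qed.

End Spectrum.

(** * The Laplacian of a graph *)

Section Laplacian.
Variables (R : rcfType) (T : finType).
Local Notation W := {ffun T -> R^o}.
Implicit Types (G H : sgraph T) (A B : {set T}) (f g : W).

Lemma adj_sym G : symmetric (adj G).
Proof. by move=> x y; rewrite /adj setUC. Qed.

Lemma adj_gsum G H x y : adj (gsum G H) x y = adj G x y || adj H x y.
Proof. by rewrite /adj inE. Qed.

Lemma adj_K A B x y : [disjoint A & B] ->
  adj (K A B) x y = (x \in A) && (y \in B) || (y \in A) && (x \in B).
Proof.
move=> dAB; apply/imset2P/idP=> [[a b aA]|].
  rewrite inE => /andP[bB _] eq_xy.
  have: b \in [set x; y] by rewrite eq_xy set22.
  have: a \in [set x; y] by rewrite eq_xy set21.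
  have ab : a != b by apply: contraTneq aA => ->; rewrite (disjointFl dAB bB).
  rewrite !inE => /pred2P[] ax /pred2P[] bx; rewrite -?ax -?bx ?aA ?bB ?orbT //.
    by rewrite ax bx eqxx in ab.
  by rewrite ax bx eqxx in ab.
have neq a b : a \in A -> b \in B -> a != b.
  by move=> aA; apply: contraTneq => <-; rewrite (disjointFr dAB aA).
case/orP=> /andP[aA bB]; first by exists x y; rewrite ?inE ?bB ?neq.
by exists y x; rewrite ?inE ?bB ?neq // setUC.
Qed.

(** The diagonal part is symmetric in [f] and [g], and so is the adjacency part
    because the adjacency relation is. *)
Lemma laplacian_self_adjoint G f g :
  dotf (laplacian R G f) g = dotf f (laplacian R G g).
Proof.
suff E (h k : W) : dotf (laplacian R G h) k
    = \sum_x \sum_(y | adj G x y) h x * k x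
      - \sum_x \sum_(y | adj G x y) h y * k x.
  rewrite [RHS]dotfC !E; congr (_ - _).
    by apply: eq_bigr => x _; apply: eq_bigr => y _; rewrite mulrC.
  rewrite (exchange_big_dep xpredT) //=; apply: eq_bigr => x _.
  by apply: eq_big => [y|y _]; [rewrite adj_sym | rewrite mulrC].
rewrite -sumrB; apply: eq_bigr => x _.
rewrite laplacianE -sumrB big_distrl; apply: eq_bigr => y _ /=.
by rewrite mulrBl.
Qed.

(** Self-adjointness gives [mu * dotf f g = nu * dotf f g]. *)
Lemma eigenvectors_orthogonal G mu nu f g :
    laplacian R G f = mu *: f -> laplacian R G g = nu *: g -> mu != nu ->
  dotf f g = 0.
Proof.
move=> Lf Lg neq; have := laplacian_self_adjoint G f g.
rewrite Lf Lg dotfZl dotfZr => /eqP; rewrite -subr_eq0 -mulrBl mulf_eq0.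
by rewrite subr_eq0 (negPf neq) => /eqP.
Qed.

Lemma free_eigenvectors G (s : seq R) (X : seq W) :
    uniq s -> size s = size X ->
    {in zip s X, forall p, eigenvector (laplacian R G) p.1 p.2} ->
  free X.
Proof.
move=> uniq_s sX eig.
have eig_nth i : (i < size X)%N -> eigenvector (laplacian R G) s`_i X`_i.
  move=> iX; apply: (eig (_, _)); rewrite -nth_zip // mem_nth //.
  by rewrite size_zip sX minnn.
apply: free_pairwise_orthogonal.
  by apply/(nthP 0)=> -[i /eig_nth[Xi0 _] Xi]; rewrite Xi eqxx in Xi0.
apply/(pairwiseP 0)=> i j iX jX ltij; apply/eqP.
have [_ Li] := eig_nth i iX; have [_ Lj] := eig_nth j jX.
by apply: eigenvectors_orthogonal Li Lj _; rewrite nth_uniq ?sX // ltn_eqF.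
Qed.

End Laplacian.

Lemma cardsU_disjoint (T : finType) (A B : {set T}) :
  [disjoint A & B] -> #|A :|: B| = (#|A| + #|B|)%N.
Proof. by move=> dAB; rewrite cardsU disjoint_setI0 // cards0 subn0. Qed.

Lemma sum_disjointU (V : nmodType) (T : finType) (A B : {set T}) (F : T -> V) :
  [disjoint A & B] ->
  \sum_(x in A :|: B) F x = \sum_(x in A) F x + \sum_(x in B) F x.
Proof. by move=> dAB; rewrite -bigU //; apply: eq_bigl => x; rewrite inE. Qed.

Lemma laplacian_nbhd (R : rcfType) (T : finType) (G : sgraph T) (A : {set T})
    (f : {ffun T -> R^o}) x :
    adj G x =i A ->
  laplacian R G f x = #|A|%:R * f x - \sum_(y in A) f y.
Proof.
move=> GA; rewrite laplacianE (eq_bigl _ _ GA) sumrB sumr_const.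
by rewrite mulr_natl.
Qed.

(** * The blocks of the barren graph *)

Section Barren.
Variables (R : rcfType) (T : finType) (N : nat).
Variables (V1 V2 V3 V4 V5 V6 : {set T}).
Hypothesis N_ge3 : (3 <= N)%N.
Hypothesis V_disjoint : pairwise (fun A B : {set T} => [disjoint A & B])
                                 [:: V1; V2; V3; V4; V5; V6].
Hypothesis V_cover : V1 :|: V2 :|: V3 :|: V4 :|: V5 :|: V6 = [set: T].
Hypotheses (cardV1 : #|V1| = N) (cardV2 : #|V2| = 1%N) (cardV3 : #|V3| = 2%N).
Hypotheses (cardV4 : #|V4| = 2%N) (cardV5 : #|V5| = 1%N) (cardV6 : #|V6| = 1%N).

Local Notation W := {ffun T -> R^o}.
Local Notation G := (barren V1 V2 V3 V4 V5 V6).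
Local Notation L := (laplacian R G).
Local Notation n := (N%:R : R).
Implicit Types (f : W) (x : T).

Lemma n_ge3 : 3 <= n.
Proof. by rewrite ler_nat. Qed.

Local Notation Vs := [:: V1; V2; V3; V4; V5; V6].

Lemma disjoint_blocks i j :
  (i < j < 6)%N -> [disjoint nth set0 Vs i & nth set0 Vs j].
Proof.
case/andP=> ltij lt6; have /(pairwiseP set0) := V_disjoint.
by apply=> //; apply: ltn_trans lt6.
Qed.

(** A case on [blockP x] evaluates all six membership tests of [x] at once. *)
Variant block_spec x : bool -> bool -> bool -> bool -> bool -> bool -> Prop :=
| Block1 of x \in V1 : block_spec x true false false false false false
| Block2 of x \in V2 : block_spec x false true false false false false
| Block3 of x \in V3 : block_spec x false false true false false false
| Block4 of x \in V4 : block_spec x false false false true false false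
| Block5 of x \in V5 : block_spec x false false false false true false
| Block6 of x \in V6 : block_spec x false false false false false true.

Lemma blockP x : block_spec x (x \in V1) (x \in V2) (x \in V3)
                              (x \in V4) (x \in V5) (x \in V6).
Proof.
have only i : (i < 6)%N -> x \in nth set0 Vs i ->
    forall j, (j < 6)%N -> (x \in nth set0 Vs j) = (j == i).
  move=> i6 xi j j6; case: ltngtP => [ltji|ltij|->] //.
    by apply: disjointFl xi; apply: disjoint_blocks; rewrite ltji.
  by apply: disjointFr xi; apply: disjoint_blocks; rewrite ltij.
have block i : (i < 6)%N -> x \in nth set0 Vs i ->
  [/\ ((x \in V1) = (0 == i)%N), ((x \in V2) = (1 == i)%N),
      ((x \in V3) = (2 == i)%N), ((x \in V4) = (3 == i)%N)
   & ((x \in V5) = (4 == i)%N) /\ ((x \in V6) = (5 == i)%N)].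
  move=> i6 /(only i i6) E.
  by split; [have := E 0%N | have := E 1%N | have := E 2%N | have := E 3%N
            | split; [have := E 4%N | have := E 5%N]]; apply.
have := in_setT x; rewrite -V_cover !inE -!orbA.
case/or4P => [||| /or3P[]] xV.
- by have [-> -> -> -> [-> ->]] := block 0%N isT xV; constructor.
- by have [-> -> -> -> [-> ->]] := block 1%N isT xV; constructor.
- by have [-> -> -> -> [-> ->]] := block 2%N isT xV; constructor.
- by have [-> -> -> -> [-> ->]] := block 3%N isT xV; constructor.
- by have [-> -> -> -> [-> ->]] := block 4%N isT xV; constructor.
- by have [-> -> -> -> [-> ->]] := block 5%N isT xV; constructor.
Qed.

Lemma adj_barren x y : adj G x y =
  [|| (x \in V1) && [|| y \in V2, y \in V3 | y \in V4],
      (x \in V2) && (y \in V1), (x \in V3) && ((y \in V1) || (y \in V5)),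
      (x \in V4) && ((y \in V1) || (y \in V6)), (x \in V5) && (y \in V3)
    | (x \in V6) && (y \in V4)].
Proof.
rewrite /barren !adj_gsum !adj_K; last first.
- exact: (@disjoint_blocks 0 1).
- exact: (@disjoint_blocks 0 2).
- exact: (@disjoint_blocks 0 3).
- exact: (@disjoint_blocks 2 4).
- exact: (@disjoint_blocks 3 5).
by case: (blockP x) => _; case: (blockP y) => _.
Qed.

Lemma vset_barren : vset G = [set: T].
Proof.
apply/setP=> x; rewrite /= !inE.
by case: (blockP x).
Qed.

Lemma card_vertices : #|T| = (N + 7)%N.
Proof.
rewrite -cardsT -V_cover !cardsU_disjoint ?cardV1 ?cardV2 ?cardV3
  ?cardV4 ?cardV5 ?cardV6.
  by rewrite -!addnA.
all: by rewrite -setI_eq0; apply/eqP/setP=> x; rewrite !inE; case: (blockP x).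
Qed.

Lemma connected_barren : connected G.
Proof.
have pick (A : {set T}) k : #|A| = k.+1 -> exists x, x \in A.
  by move=> cA; apply/card_gt0P; rewrite cA.
have [w w1] : exists w, w \in V1.
  by apply/card_gt0P; rewrite cardV1 (leq_trans _ N_ge3).
have [[u u3] [v v4]] := (pick _ _ cardV3, pick _ _ cardV4).
have step x y : adj G x y -> connect (adj G) x w -> connect (adj G) y w.
  by move=> xy; apply: connect_trans; apply: connect1; rewrite adj_sym.
have from2 x : x \in V2 -> connect (adj G) x w.
  by move=> x2; apply: connect1; rewrite adj_barren x2 w1 orbT.
have from3 x : x \in V3 -> connect (adj G) x w.
  by move=> x3; apply: connect1; rewrite adj_barren x3 w1 !orbT.
have from4 x : x \in V4 -> connect (adj G) x w.
  by move=> x4; apply: connect1; rewrite adj_barren x4 w1 !orbT.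
have to_w x : connect (adj G) x w.
  have : [|| x \in V1, x \in V2, x \in V3, x \in V4, x \in V5 | x \in V6].
    by case: (blockP x).
  case/or4P => [x1|x2|x3|/or3P[x4|x5|x6]];
    [|exact: from2|exact: from3|exact: from4| |].
  - by apply: step (from3 u u3); rewrite adj_barren u3 x1 !orbT.
  - by apply: step (from3 u u3); rewrite adj_barren u3 x5 !orbT.
  - by apply: step (from4 v v4); rewrite adj_barren v4 x6 !orbT.
move=> x y _ _; apply: connect_trans (to_w x) _.
by rewrite (sym_connect_sym (@adj_sym _ G)).
Qed.

Local Notation S A f := (\sum_(y in A) (f : W) y).

Lemma laplacian_barren f x : L f x =
  if x \in V1 then 5 * f x - (S V2 f + S V3 f + S V4 f)
  else if x \in V2 then n * f x - S V1 f
  else if x \in V3 then (n + 1) * f x - (S V1 f + S V5 f)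
  else if x \in V4 then (n + 1) * f x - (S V1 f + S V6 f)
  else if x \in V5 then 2 * f x - S V3 f
  else 2 * f x - S V4 f.
Proof.
have dis234 : [disjoint V2 :|: V3 & V4].
  by rewrite -setI_eq0; apply/eqP/setP=> y; rewrite !inE; case: (blockP y).
have nbhd (A : {set T}) : (forall y, adj G x y = (y \in A)) ->
  L f x = #|A|%:R * f x - S A f by apply: laplacian_nbhd.
have := adj_barren x; case: (blockP x) => _ /= adjx.
- rewrite (nbhd (V2 :|: V3 :|: V4)) => [|y].
    by rewrite !sum_disjointU ?cardsU_disjoint ?cardV2 ?cardV3 ?cardV4 //;
      exact: (@disjoint_blocks 1 2).
  by rewrite adjx !inE orbF orbA.
- by rewrite (nbhd V1) ?cardV1 // => y; rewrite adjx orbF.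
- rewrite (nbhd (V1 :|: V5)) => [|y]; last by rewrite adjx !inE orbF.
  rewrite sum_disjointU ?cardsU_disjoint ?cardV1 ?cardV5 ?natrD //;
    exact: (@disjoint_blocks 0 4).
- rewrite (nbhd (V1 :|: V6)) => [|y]; last by rewrite adjx !inE orbF.
  rewrite sum_disjointU ?cardsU_disjoint ?cardV1 ?cardV6 ?natrD //;
    exact: (@disjoint_blocks 0 5).
- by rewrite (nbhd V3) ?cardV3 // => y; rewrite adjx orbF.
- by rewrite (nbhd V4) ?cardV4 // => y; rewrite adjx.
Qed.

(** * Eigenvectors of the barren graph *)

Definition blockf (c1 c2 c3 c4 c5 c6 : R) : W :=
  [ffun x => if x \in V1 then c1 else if x \in V2 then c2
             else if x \in V3 then c3 else if x \in V4 then c4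
             else if x \in V5 then c5 else c6].

Lemma equals_on_blockf c1 c2 c3 c4 c5 c6 (f := blockf c1 c2 c3 c4 c5 c6) :
  [/\ equals_on V1 f c1, equals_on V2 f c2, equals_on V3 f c3,
      equals_on V4 f c4 & equals_on V5 f c5 /\ equals_on V6 f c6].
Proof. by do !split; move=> x; rewrite ffunE; case: (blockP x). Qed.

Lemma sum_equals_on (A : {set T}) f c : equals_on A f c -> S A f = #|A|%:R * c.
Proof. by move=> fA; rewrite (eq_bigr _ fA) sumr_const mulr_natl. Qed.

(** The quotient matrix of the Laplacian: the vertices of one block all have the
    same number of neighbours in each block, so block functions are stable. *)
Lemma laplacian_blockf c1 c2 c3 c4 c5 c6 :
  L (blockf c1 c2 c3 c4 c5 c6) =
  blockf (5 * c1 - (c2 + 2 * c3 + 2 * c4)) (n * c2 - n * c1)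
         ((n + 1) * c3 - (n * c1 + c5)) ((n + 1) * c4 - (n * c1 + c6))
         (2 * c5 - 2 * c3) (2 * c6 - 2 * c4).
Proof.
apply/ffunP=> x; rewrite laplacian_barren.
have [/sum_equals_on-> /sum_equals_on-> /sum_equals_on-> /sum_equals_on->] :=
  equals_on_blockf c1 c2 c3 c4 c5 c6.
case=> /sum_equals_on-> /sum_equals_on->.
rewrite cardV1 cardV2 cardV3 cardV4 cardV5 cardV6 !mul1r !ffunE.
by case: (blockP x).
Qed.

Lemma scale_blockf mu c1 c2 c3 c4 c5 c6 :
  mu *: blockf c1 c2 c3 c4 c5 c6 =
  blockf (mu * c1) (mu * c2) (mu * c3) (mu * c4) (mu * c5) (mu * c6).
Proof. by apply/ffunP=> x; rewrite !ffunE; case: (blockP x). Qed.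

Lemma blockf_neq0 c1 c2 c3 c4 c5 c6 :
  c5 != 0 -> blockf c1 c2 c3 c4 c5 c6 != 0.
Proof.
have [x x5] : exists x, x \in V5 by apply/card_gt0P; rewrite cardV5.
apply: contraNneq => /ffunP/(_ x).
by rewrite !ffunE; move: x5; case: (blockP x) => // _ _ ->.
Qed.

(** The row of a degree-2 vertex reads [2 c5 - 2 c3 = mu c5]; taking [c5 = 2]
    forces [c3 = 2 - mu], and the remaining equation is [quadratic n mu = 0]. *)
Definition antisym_vector (mu : R) : W :=
  blockf 0 0 (2 - mu) (- (2 - mu)) 2 (- 2).

(** Solved from the end of the path V5, V3, V1, V2 of the quotient, scaled by [n]
    to avoid denominators: the row of V5 gives the value on V3, that of V3 the
    value on V1, and that of V1 the value on V2.  The row of V2 is then the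
    equation [mu * cubic n mu = 0]. *)
Definition sym_vector (mu : R) : W :=
  blockf (quadratic n mu) ((5 - mu) * quadratic n mu - 4 * (n * (2 - mu)))
         (n * (2 - mu)) (n * (2 - mu)) (2 * n) (2 * n).

Lemma antisym_vector_on_blocks mu (f := antisym_vector mu) : exists a b : R,
  [/\ equals_on V3 f a, equals_on V4 f (- a),
      equals_on V5 f b, equals_on V6 f (- b)
    & equals_on (V1 :|: V2) f 0].
Proof.
have [f1 f2 f3 f4 [f5 f6]] :=
  equals_on_blockf 0 0 (2 - mu) (- (2 - mu)) 2 (- 2).
by exists (2 - mu), 2; split=> // x /setUP[/f1|/f2].
Qed.

Lemma sym_vector_on_blocks mu (f := sym_vector mu) :
  [/\ constant_on V1 f, constant_on V2 f,
      constant_on (V3 :|: V4) f & constant_on (V5 :|: V6) f].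
Proof.
have [f1 f2 f3 f4 [f5 f6]] := equals_on_blockf (quadratic n mu)
  ((5 - mu) * quadratic n mu - 4 * (n * (2 - mu)))
  (n * (2 - mu)) (n * (2 - mu)) (2 * n) (2 * n).
have const (A : {set T}) c : equals_on A f c -> constant_on A f.
  by move=> fA x y /fA-> /fA->.
have onU (A B : {set T}) c :
    equals_on A f c -> equals_on B f c -> equals_on (A :|: B) f c.
  by move=> fA fB x /setUP[/fA|/fB].
by split; [exact: const f1 | exact: const f2 | exact: const (onU _ _ _ f3 f4)
          | exact: const (onU _ _ _ f5 f6)].
Qed.

Lemma antisym_eigenvector mu :
  quadratic n mu = 0 -> eigenvector L mu (antisym_vector mu).
Proof.
move=> q0; split; first by rewrite blockf_neq0 ?pnatr_eq0.
have q : (n + 1) * (2 - mu) - 2 = mu * (2 - mu).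
  by apply/eqP; rewrite -subr_eq0 -q0 /quadratic; apply/eqP; ring.
rewrite /antisym_vector laplacian_blockf scale_blockf; congr blockf; try ring.
  by rewrite -q; ring.
by rewrite [mu * _]mulrN -q; ring.
Qed.

Lemma sym_eigenvector mu :
  cubic n mu = 0 -> eigenvector L mu (sym_vector mu).
Proof.
move=> c0; split.
  by rewrite blockf_neq0 // mulf_neq0 ?pnatr_eq0 // -lt0n (leq_trans _ N_ge3).
rewrite /sym_vector laplacian_blockf scale_blockf; congr blockf;
  rewrite /quadratic; try ring.
(* The row of V2 is the only one that is not an identity. *)
apply/eqP; rewrite -subr_eq0; apply/eqP.
transitivity (mu * cubic n mu); last by rewrite c0 mulr0.
by rewrite /cubic; ring.
Qed.

Lemma zero_sum_laplacian f : f \in zero_sum_space R V1 -> L f = 5 *: f.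
Proof.
rewrite mem_zero_sum_space => /andP[fV1 /eqP sum_f].
have f0 x : x \notin V1 -> f x = 0 := eq0_off_supp fV1.
have S0 (A : {set T}) : [disjoint V1 & A] -> S A f = 0.
  by move=> d; rewrite big1 // => x xA; rewrite f0 // (disjointFl d xA).
have S1 : S V1 f = 0.
  by rewrite -[RHS]sum_f [RHS](bigID [in V1]) /= [X in _ + X]big1 ?addr0.
have S2 := S0 V2 (@disjoint_blocks 0 1 isT).
have S3 := S0 V3 (@disjoint_blocks 0 2 isT).
have S4 := S0 V4 (@disjoint_blocks 0 3 isT).
have S5 := S0 V5 (@disjoint_blocks 0 4 isT).
have S6 := S0 V6 (@disjoint_blocks 0 5 isT).
apply/ffunP=> x; rewrite laplacian_barren scale_ffunE S1 S2 S3 S4 S5 S6.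
by have := f0 x; case: (blockP x) => _ => [_|E|E|E|E|E]; rewrite ?E //; ring.
Qed.

Section TwoPairs.
Variables (u u' v v' : T) (a b : R).
Hypotheses (V3E : V3 = [set u; u']) (V4E : V4 = [set v; v']).
Local Notation k := (two_pairs u u' v v' a b).

Lemma two_pairs_distinct : uniq [:: u; u'; v; v'].
Proof.
have d34 : [disjoint V3 & V4] := @disjoint_blocks 2 3 isT.
have uu : u != u' by have := cardV3; rewrite V3E cards2; case: eqP.
have vv : v != v' by have := cardV4; rewrite V4E cards2; case: eqP.
have uV3 : u \in V3 by rewrite V3E set21.
have u'V3 : u' \in V3 by rewrite V3E set22.
have := disjointFr d34 uV3; have := disjointFr d34 u'V3.
rewrite V4E /= !inE !negb_or uu vv => /negbT; rewrite negb_or => ->.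
by move=> /negbT; rewrite negb_or => ->.
Qed.

Lemma two_pairsE : [/\ k u = a, k u' = - a, k v = b & k v' = - b].
Proof.
have := two_pairs_distinct; rewrite /= !inE !negb_or andbT => /and3P[].
move=> /and3P[/negPf uu' /negPf uv /negPf uv'] /andP[/negPf u'v /negPf u'v'].
move=> /negPf vv'; rewrite !ffunE !eqxx.
by rewrite ![u' == u]eq_sym ![v == _]eq_sym ![v' == _]eq_sym uu'
  uv uv' u'v u'v' vv'.
Qed.

Lemma two_pairs_off x : x \notin V3 -> x \notin V4 -> k x = 0.
Proof.
by rewrite V3E V4E !inE !negb_or ffunE => /andP[/negPf-> /negPf->]
  /andP[/negPf-> /negPf->].
Qed.

Lemma two_pairs_laplacian : L k = (n + 1) *: k.
Proof.
have [ku ku' kv kv'] := two_pairsE.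
have := two_pairs_distinct; rewrite /= !inE !negb_or andbT => /and3P[].
move=> /and3P[uu' _ _] _ vv'.
have S3 : S V3 k = 0.
  by rewrite V3E big_setU1 /= ?big_set1 ?ku ?ku' ?subrr // inE.
have S4 : S V4 k = 0.
  by rewrite V4E big_setU1 /= ?big_set1 ?kv ?kv' ?subrr // inE.
have S0 (A : {set T}) : [disjoint V3 & A] -> [disjoint V4 & A] -> S A k = 0.
  move=> d3 d4; rewrite big1 // => x xA.
  by rewrite two_pairs_off ?(disjointFl d3 xA) ?(disjointFl d4 xA).
have dC (A B : {set T}) : [disjoint A & B] -> [disjoint B & A].
  by rewrite disjoint_sym.
have S1 : S V1 k = 0.
  by apply: S0; apply: dC;
    [apply: (@disjoint_blocks 0 2) | apply: (@disjoint_blocks 0 3)].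
have S2 : S V2 k = 0.
  by apply: S0; apply: dC;
    [apply: (@disjoint_blocks 1 2) | apply: (@disjoint_blocks 1 3)].
have S5 : S V5 k = 0.
  by apply: S0; [apply: (@disjoint_blocks 2 4) | apply: (@disjoint_blocks 3 4)].
have S6 : S V6 k = 0.
  by apply: S0; [apply: (@disjoint_blocks 2 5) | apply: (@disjoint_blocks 3 5)].
apply/ffunP=> x; rewrite laplacian_barren scale_ffunE S1 S2 S3 S4 S5 S6.
by have := @two_pairs_off x; case: (blockP x) => _ => [E|E|_|_|E|E];
  rewrite ?E //; ring.
Qed.

End TwoPairs.

Lemma two_pairs_eigenvector u u' v v' (a b : R) :
    V3 = [set u; u'] -> V4 = [set v; v'] -> (a != 0) || (b != 0) ->
  eigenvector L (n + 1) (two_pairs u u' v v' a b).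
Proof.
move=> V3E V4E ab; split; last exact: two_pairs_laplacian.
have [ku _ kv _] := two_pairsE a b V3E V4E.
apply/eqP=> k0; rewrite k0 ffunE in ku; rewrite k0 ffunE in kv.
by move: ab; rewrite -ku -kv eqxx.
Qed.

(** A scalar relating the two vectors would be 1 on [V3] and -1 on [V4].  They
    are not orthogonal unless [a] and [b] have the same absolute value. *)
Lemma free_two_pairs u u' v v' (a b : R) :
    V3 = [set u; u'] -> V4 = [set v; v'] -> a != 0 -> b != 0 ->
  free [:: two_pairs u u' v v' a b; two_pairs u u' v v' a (- b)].
Proof.
move=> V3E V4E a0 b0; have [ku _ kv _] := two_pairsE a b V3E V4E.
have [k'u _ k'v _] := two_pairsE a (- b) V3E V4E.
rewrite free_cons seq1_free span_seq1; apply/andP; split; last first.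
  have ab : (a != 0) || (- b != 0) by rewrite a0.
  by have [] := two_pairs_eigenvector V3E V4E ab.
apply/vlineP=> -[c k_ck'].
have := ku; have := kv; rewrite k_ck' !scale_ffunE k'u k'v => cb ca.
have c1 : c = 1 by apply: (mulIf a0); rewrite ca mul1r.
by apply: (elimN eqP b0); move: cb; rewrite c1; lra.
Qed.

(** * The spectrum of the barren graph *)

Section BarrenSpectrum.
Variables y1 y2 y3 : R.
Hypotheses (y1_bounds : 2 <= y1 < n) (y2_bounds : n < y2 < n + 1).
Hypothesis y3_bound : n + 1 < y3.
Hypotheses (y1_root : cubic n y1 = 0) (y2_root : cubic n y2 = 0).
Hypothesis y3_root : cubic n y3 = 0.

Definition simple_eigenvalues : seq R :=
  [:: 0; qroot1 n; qroot2 n; y1; y2; y3].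

Definition simple_eigenvectors : seq W :=
  [:: cst T 1; antisym_vector (qroot1 n); antisym_vector (qroot2 n);
      sym_vector y1; sym_vector y2; sym_vector y3].

Lemma simple_eigenpairs :
  {in zip simple_eigenvalues simple_eigenvectors,
    forall p, eigenvector L p.1 p.2}.
Proof.
have [q1 q2] := quadratic_roots n_ge3.
move=> p; rewrite /= !inE.
case/orP=> [|/orP[|/orP[|/orP[|/orP[]]]]] /eqP-> /=.
- have [x _] : exists x, x \in V2 by apply/card_gt0P; rewrite cardV2.
  split; last first.
    apply/ffunP=> y; rewrite laplacianE big1 ?scale_ffunE ?mul0r // => z _.
    by rewrite !ffunE subrr.
  by apply/eqP=> /ffunP/(_ x)/eqP; rewrite !ffunE oner_eq0.
- exact: antisym_eigenvector.
- exact: antisym_eigenvector.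
- exact: sym_eigenvector.
- exact: sym_eigenvector.
- exact: sym_eigenvector.
Qed.

(** At 5 both characteristic polynomials are nonzero because [N] is an integer:
    their values are [10 - 3 n] and [n * (3 n - 14)]. *)
Lemma simple_eigenvalues_neq mu :
  mu \in simple_eigenvalues -> mu != 5 /\ mu != n + 1.
Proof.
have n3 := n_ge3; have [q1 q2] := quadratic_roots n3.
have natneq a b : (a * N != b)%N -> a%:R * n - b%:R != 0.
  by rewrite subr_eq0 -natrM eqr_nat.
have q5 : quadratic n 5 != 0.
  rewrite (_ : quadratic n 5 = - (3 * n - 10)); last first.
    by rewrite /quadratic; ring.
  rewrite oppr_eq0; apply: (natneq 3%N 10%N); apply/eqP=> /(congr1 (modn^~ 3)).
  by rewrite modnMr.
have c5 : cubic n 5 != 0.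
  rewrite (_ : cubic n 5 = n * (3 * n - 14)); last by rewrite /cubic; ring.
  apply: mulf_neq0; first by rewrite lt0r_neq0 //; lra.
  apply: (natneq 3%N 14%N); apply/eqP=> /(congr1 (modn^~ 3)).
  by rewrite modnMr.
have qn : quadratic n (n + 1) != 0.
  by rewrite (_ : quadratic _ _ = -2) ?oppr_eq0 ?pnatr_eq0 // /quadratic; ring.
have cn : cubic n (n + 1) != 0.
  rewrite (_ : cubic _ _ = 8 - 4 * n); last by rewrite /cubic; ring.
  by rewrite lt_eqF; lra.
have neq (p : R -> R) (x y : R) : p x = 0 -> p y != 0 -> x != y.
  by move=> px0; apply: contraNneq => <-; rewrite px0.
rewrite !inE; case/orP=> [|/orP[|/orP[|/orP[|/orP[]]]]] /eqP->;
  split; try by [apply: (neq (quadratic n)) | apply: (neq (cubic n))].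
  by rewrite eq_sym pnatr_eq0.
by rewrite lt_eqF //; lra.
Qed.

Section Eigenbasis.
Variables (h : seq W) (u u' v v' : T) (a b : R).
Hypothesis h_basis : orthonormal_basis_of (supported_orth_const V1) h.
Hypotheses (V3E : V3 = [set u; u']) (V4E : V4 = [set v; v']).
Hypotheses (a_neq0 : a != 0) (b_neq0 : b != 0).

Let pairs := [:: two_pairs u u' v v' a b; two_pairs u u' v v' a (- b)].

Lemma size_zero_sum_basis : size h = N.-1.
Proof. by rewrite (size_orthonormal_basis h_basis) cardV1. Qed.

Lemma zero_sum_basis_laplacian f : f \in h -> L f = 5 *: f.
Proof.
move=> hf; apply: zero_sum_laplacian.
by rewrite -(orthonormal_basis_span h_basis) memv_span.
Qed.

Lemma pairs_laplacian f : f \in pairs -> L f = (n + 1) *: f.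
Proof. by rewrite !inE => /orP[] /eqP->; apply: two_pairs_laplacian. Qed.

(** The three groups of vectors are pairwise orthogonal.  The two last ones have
    disjoint supports; their eigenvalues 5 and [n + 1] are equal when [N] is 4,
    so eigenvalues alone would not separate them. *)
Lemma free_eigenbasis : free (simple_eigenvectors ++ h ++ pairs).
Proof.
have simple f : f \in simple_eigenvectors ->
  exists2 mu, mu \in simple_eigenvalues & L f = mu *: f.
  move=> sf; have iX := sf; rewrite -index_mem in iX.
  set i := index f simple_eigenvectors in iX.
  have [|_] :=
      @simple_eigenpairs (simple_eigenvalues`_i, simple_eigenvectors`_i).
    by rewrite -nth_zip // mem_nth.
  rewrite /= nth_index // => Lf; exists simple_eigenvalues`_i => //.
  exact: mem_nth.
apply: free_orthogonal_cat.
- apply: free_eigenvectors simple_eigenpairs => //.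
  by apply: uniq_spectrum => //; apply: n_ge3.
- apply: free_orthogonal_cat; first by case: h_basis => /free_orthonormal.
    exact: free_two_pairs.
  move=> f k hf; rewrite !inE => k_pair; rewrite /dotf big1 // => x _.
  have : f \in zero_sum_space R V1.
    by rewrite -(orthonormal_basis_span h_basis) memv_span.
  rewrite mem_zero_sum_space => /andP[fV1 _].
  have [x1|x1] := boolP (x \in V1); last first.
    by rewrite (eq0_off_supp fV1 x1) mul0r.
  have [x3 x4] : x \notin V3 /\ x \notin V4 by move: x1; case: (blockP x).
  by case/orP: k_pair => /eqP->; rewrite two_pairs_off ?mulr0.
- move=> f g /simple[mu /simple_eigenvalues_neq[mu5 mun] Lf].
  rewrite mem_cat => /orP[/zero_sum_basis_laplacian|/pairs_laplacian] Lg.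
    exact: eigenvectors_orthogonal Lf Lg mu5.
  exact: eigenvectors_orthogonal Lf Lg mun.
Qed.

Lemma dim_eigenspace mu : \dim (passmx.leigenspace L mu) =
  count_mem mu (simple_eigenvalues ++ nseq N.-1 5 ++ nseq 2 (n + 1)).
Proof.
apply: (@dim_leigenspace_count _ _ _ _ (simple_eigenvectors ++ h ++ pairs)).
- rewrite basisEfree free_eigenbasis subvf dim_functions card_vertices.
  rewrite !size_cat size_zero_sum_basis /=; case: N N_ge3 => // m _.
  by rewrite !addnS !addn0.
- by rewrite !size_cat !size_nseq size_zero_sum_basis.
- move=> p; rewrite !zip_cat ?size_nseq ?size_zero_sum_basis // !mem_cat.
  case/or3P=> [/simple_eigenpairs[]//|/(nthP (0, 0))[i]|].
    rewrite size_zip size_nseq size_zero_sum_basis minnn => iN <-.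
    rewrite nth_zip ?size_nseq ?size_zero_sum_basis // nth_nseq iN /=.
    by rewrite zero_sum_basis_laplacian ?mem_nth ?size_zero_sum_basis.
  by rewrite !inE => /orP[] /eqP-> /=; apply: two_pairs_laplacian.
Qed.

End Eigenbasis.

Local Notation spectrum :=
  (simple_eigenvalues ++ nseq N.-1 5 ++ nseq 2 (n + 1)).

Lemma dim_leigenspace_barren mu :
  \dim (passmx.leigenspace L mu) = count_mem mu spectrum.
Proof.
have [h h_basis] := supported_orth_const_basis R V1.
have /eqP/cards2P[u [u' [_ V3E]]] := cardV3.
have /eqP/cards2P[v [v' [_ V4E]]] := cardV4.
exact: (dim_eigenspace h_basis V3E V4E (oner_neq0 R) (oner_neq0 R)).
Qed.

Lemma leigenvalue_barren mu :
  passmx.leigenvalue L mu = (mu \in spectrum).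
Proof.
by rewrite /passmx.leigenvalue -dimv_eq0 dim_leigenspace_barren -has_pred1
  has_count lt0n.
Qed.

(** 2 separates [qroot1 n] from all the larger eigenvalues. *)
Lemma qroot1_smallest : smallest_pos_eigenvalue L (qroot1 n).
Proof.
have n3 := n_ge3; have [q1_gt0 q1_lt2 q2_gt] := quadratic_roots_bounds n3.
have /andP[y1_ge2 _] := y1_bounds; have /andP[y2_gt _] := y2_bounds.
have y3_gt := y3_bound.
split=> //; first by rewrite leigenvalue_barren !inE eqxx orbT.
move=> nu; rewrite leigenvalue_barren !mem_cat !mem_nseq !inE.
have [-> //|_ /=] := eqVneq nu 0; first by rewrite ltxx.
have [-> //|_ /=] := eqVneq nu (qroot1 n).
case/or3P=> [/or4P[]|/andP[_]|] /eqP-> _; lra.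
Qed.

Lemma dim_leigenspace_qroot1 : \dim (passmx.leigenspace L (qroot1 n)) = 1%N.
Proof.
have q1_simple : qroot1 n \in simple_eigenvalues by rewrite !inE eqxx orbT.
have [q1_neq5 q1_neqn1] := simple_eigenvalues_neq q1_simple.
rewrite dim_leigenspace_barren !count_cat count_uniq_mem; last first.
  by apply: uniq_spectrum => //; apply: n_ge3.
by rewrite q1_simple !count_nseq /= ![_ == qroot1 n]eq_sym (negPf q1_neq5)
  (negPf q1_neqn1).
Qed.

(** The eigenspace is the line of the odd vector, whose values off [V1] and [V2]
    are [2 - qroot1 n] and 2 up to sign, both nonzero. *)
Lemma fiedler_vector_barren (phi : W) : fiedler_vector G phi ->
  equals_on (V1 :|: V2) phi 0 /\ #|supp phi| = 6%N.
Proof.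
case=> mu [mu_eig mu_gt0 mu_min] [phi0 Lphi].
have [q1_eig q1_gt0 q1_min] := qroot1_smallest.
have mu_q1 : mu = qroot1 n by apply/le_anti; rewrite mu_min ?q1_min.
have [q1_root _] := quadratic_roots n_ge3.
have [_ q1_lt2 _] := quadratic_roots_bounds n_ge3.
have [f0 Lf] := antisym_eigenvector q1_root.
have /vlineP[c phiE] : phi \in <[antisym_vector (qroot1 n)]>%VS.
  suff <- : passmx.leigenspace L (qroot1 n) = <[antisym_vector (qroot1 n)]>%VS.
    by rewrite mem_leigenspace Lphi mu_q1.
  apply/esym/eqP; rewrite eqEdim dim_leigenspace_qroot1 dim_vline f0 andbT.
  by rewrite -memvE mem_leigenspace Lf.
have c0 : c != 0 by apply: contraNneq phi0 => c0; rewrite phiE c0 scale0r.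
have phi_supp x : (phi x != 0) = (x \notin V1 :|: V2).
  rewrite phiE scale_ffunE mulf_eq0 (negPf c0) ffunE inE.
  by case: (blockP x) => _ /=; rewrite ?oppr_eq0 ?pnatr_eq0 ?eqxx //
    subr_eq0 gt_eqF.
split.
  by move=> x x12; apply/eqP; rewrite -[_ == _]negbK phi_supp x12.
have -> : supp phi = ~: (V1 :|: V2).
  by apply/setP=> x; rewrite in_setC inE phi_supp.
rewrite cardsCs setCK card_vertices cardsU_disjoint ?cardV1 ?cardV2 ?subnDl //.
exact: (@disjoint_blocks 0 1).
Qed.

End BarrenSpectrum.

End Barren.

Theorem theorem3p12 (R : rcfType) (T : finType) (N : nat)
    (V1 V2 V3 V4 V5 V6 : {set T})
    (N_ge3 : (3 <= N)%N)
    (V_disjoint : pairwise (fun A B : {set T} => [disjoint A & B])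
                           [:: V1; V2; V3; V4; V5; V6])
    (V_cover : V1 :|: V2 :|: V3 :|: V4 :|: V5 :|: V6 = [set: T])
    (cardV1 : #|V1| = N) (cardV2 : #|V2| = 1%N) (cardV3 : #|V3| = 2%N)
    (cardV4 : #|V4| = 2%N) (cardV5 : #|V5| = 1%N) (cardV6 : #|V6| = 1%N) :
  let W := {ffun T -> R^o} in
  let G := barren V1 V2 V3 V4 V5 V6 in
  let L : 'End(W) := laplacian R G in
  let n : R := N%:R in
  let lam1 : R := (n + 3 - Num.sqrt (n ^+ 2 - 2 * n + 9)) / 2 in
  let lam2 : R := (n + 3 + Num.sqrt (n ^+ 2 - 2 * n + 9)) / 2 in
  [/\ #|vset G| = (N + 7)%N /\ connected G,
      exists y1 y2 y3 : R,
        [/\ barren_cubic R N = ('X - y1%:P) * ('X - y2%:P) * ('X - y3%:P),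
            forall mu : R,
              \dim (passmx.leigenspace L mu) =
              count_mem mu ([:: 0; lam1; lam2; y1; y2; y3]
                            ++ nseq N.-1 5 ++ nseq 2 (n + 1)),
            exists h : seq W,
              orthonormal_basis_of (supported_orth_const V1) h
          & exists f0 f1 f2 g1 g2 g3 : W,
            [/\ eigenvector L 0 f0 /\ constant_on [set: T] f0,
                (forall p : R * W, p \in [:: (lam1, f1); (lam2, f2)] ->
                   eigenvector L p.1 p.2 /\
                   exists a b : R,
                     [/\ equals_on V3 p.2 a, equals_on V4 p.2 (- a),
                         equals_on V5 p.2 b, equals_on V6 p.2 (- b)
                       & equals_on (V1 :|: V2) p.2 0]),
                (forall p : R * W, p \in [:: (y1, g1); (y2, g2); (y3, g3)] ->
                   eigenvector L p.1 p.2 /\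
                   [/\ constant_on V1 p.2, constant_on V2 p.2,
                       constant_on (V3 :|: V4) p.2
                     & constant_on (V5 :|: V6) p.2])
              & forall (h : seq W) (u u' v v' : T) (a b : R),
                  orthonormal_basis_of (supported_orth_const V1) h ->
                  V3 = [set u; u'] -> V4 = [set v; v'] ->
                  let k := two_pairs u u' v v' a b in
                  let k' := two_pairs u u' v v' a (- b) in
                  [/\ size h = N.-1,
                      (forall f, f \in h -> eigenvector L 5 f),
                      ((a != 0) || (b != 0) ->
                         eigenvector L (n + 1) k /\ eigenvector L (n + 1) k')
                    & (a != 0 -> b != 0 ->
                         free ([:: f0; f1; f2; g1; g2; g3]
                               ++ h ++ [:: k; k']))]]],
      smallest_pos_eigenvalue L lam1
    & forall phi : W, fiedler_vector G phi ->
        equals_on (V1 :|: V2) phi 0 /\ #|supp phi| = 6%N].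
Proof.
move=> W G L n lam1 lam2.
have n3 : 3 <= n := n_ge3 R N_ge3.
have [y1 [y2 [y3 [y1_in y2_in y3_gt r1 [r2 r3]]]]] := cubic_roots n3.
have y_uniq : uniq [:: y1; y2; y3].
  have := uniq_spectrum n3 y1_in y2_in y3_gt r1 r2 r3.
  by rewrite -[X in uniq X](cat_take_drop 3) cat_uniq => /and3P[].
split.
- split; last exact: connected_barren N_ge3 _ _ cardV1 cardV3 cardV4.
  rewrite (vset_barren V_disjoint V_cover) cardsT.
  exact: (card_vertices V_disjoint V_cover).
- exists y1, y2, y3; split.
  + exact: cubic_poly_factor.
  + exact: (dim_leigenspace_barren N_ge3 V_disjoint V_cover cardV1 cardV2
              cardV3 cardV4 cardV5 cardV6 y1_in y2_in y3_gt).
  + exact: supported_orth_const_basis.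
  have simple := simple_eigenpairs N_ge3 V_disjoint V_cover cardV1 cardV2
    cardV3 cardV4 cardV5 cardV6 r1 r2 r3.
  pose asym := antisym_vector V1 V2 V3 V4 V5 : R -> W.
  pose sym := sym_vector N V1 V2 V3 V4 V5 : R -> W.
  exists (cst T 1), (asym lam1), (asym lam2), (sym y1), (sym y2), (sym y3).
  split.
  + split; first by apply: (simple (0, _)); rewrite inE eqxx.
    by move=> x y _ _; rewrite !ffunE.
  + move=> p; rewrite !inE => /pred2P p_eq; split.
      by apply: simple; case: p_eq => ->; rewrite !inE eqxx ?orbT.
    by case: p_eq => -> /=; apply: antisym_vector_on_blocks.
  + move=> p; rewrite !inE => p_eq; split.
      by apply: simple; case/or3P: p_eq => /eqP->; rewrite !inE eqxx ?orbT.
    by case/or3P: p_eq => /eqP-> /=; apply: sym_vector_on_blocks.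
  + move=> h u u' v v' a b h_basis V3E V4E k k'.
    have pair_eigenvector := two_pairs_eigenvector V_disjoint V_cover cardV1
      cardV2 cardV3 cardV4 cardV5 cardV6.
    split.
    * by rewrite (size_orthonormal_basis h_basis) cardV1.
    * move=> f hf; split.
        by case: h_basis => /free_orthonormal/free_not0-/(_ _ hf).
      exact: (zero_sum_basis_laplacian V_disjoint V_cover cardV1 cardV2
                cardV3 cardV4 cardV5 cardV6 h_basis).
    * move=> ab; split; first exact: pair_eigenvector.
      by apply: pair_eigenvector; rewrite ?oppr_eq0.
    * move=> a0 b0.
      exact: (free_eigenbasis N_ge3 V_disjoint V_cover cardV1 cardV2 cardV3
                cardV4 cardV5 cardV6 y1_in y2_in y3_gt).
- exact: (qroot1_smallest N_ge3 V_disjoint V_cover cardV1 cardV2 cardV3 cardV4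
            cardV5 cardV6 y1_in y2_in y3_gt).
- exact: (fiedler_vector_barren N_ge3 V_disjoint V_cover cardV1 cardV2 cardV3
            cardV4 cardV5 cardV6 y1_in y2_in y3_gt).
Qed.
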